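(* Let $T$ be an ergodic, invertible, measure-preserving map of a standard probability space $(X,\mathcal B,\mu)$. (1) Assume that $F:X\to\mathbb R$ is a measurable function having either an upper barrier or a lower barrier, and that $f=F-F\circ T$ is an integrable function with $\int f\,d\mu=0$. Then there exists a set $E$ of positive measure such that $\mathbb A_{[N]}f(T^nx)$ fails to fluctuate on $E$, that is, for every $x\in E$, either $\mathbb A_{[N]}f(T^nx)\ge 0$ for all sufficiently large $N$, or $\mathbb A_{[N]}f(T^nx)\le 0$ for all sufficiently large $N$. (2) Conversely, assume that for some real-valued $f\in L^1(X)$ with $\int f\,d\mu=0$, $\mathbb A_{[N]}f(T^nx)$ fails to fluctuate on a set of positive measure (in the sense of (1)). Then $f$ can be expressed ($\mu$-a.e.) as $F-F\circ T$ for some real-valued measurable function $F$ that has either an upper barrier or a lower barrier.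
   Context: For $N\ge1$, $\mathbb A_{[N]}f(T^nx)=\frac1N\sum_{n=1}^{N}f(T^nx)$. A real-valued measurable function $F$ on $X$ has an upper barrier if there is a constant $p$ and a set $P$ of positive measure on which $F$ is constantly equal to $p$, and $F(y)\le p$ for a.e. $y\in X$. It has a lower barrier if there is a constant $q$ and a set $Q$ of positive measure on which $F$ is constantly equal to $q$, and $F(y)\ge q$ for a.e. $y\in X$. *)

(* Defs.v *)
From HB Require Import structures.
From mathcomp Require Export all_boot all_order all_algebra.
From mathcomp Require Export all_classical all_reals all_analysis.

Set Implicit Arguments.
Unset Strict Implicit.
Unset Printing Implicit Defensive.

Import Order.TTheory GRing.Theory Num.Theory.
Import numFieldNormedType.Exports.

Local Open Scope classical_set_scope.
Local Open Scope ring_scope.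

(* The sigma-algebra of X lies between the Borel sigma-algebra of a Polish
   topology (transported from Y along the bijection phi) and its
   mu-completion: this covers both standard Borel spaces and their
   completions.  A hausdorff complete pseudometric space is a complete metric
   space; second countability is then separability. *)
Definition standard_space (R : realType) (d : measure_display)
    (X : measurableType d) (mu : {measure set X -> \bar R}) : Prop :=
  exists (Y : completePseudoMetricType R) (phi : X -> Y),
    [/\ hausdorff_space Y,
        @second_countable Y,
        bijective phi,
        (forall B : set Y, <<s @open Y >> B -> measurable (phi @^-1` B)) &
        (forall A : set X, measurable A ->
           exists B1 B2 : set Y,
             [/\ <<s @open Y >> B1, <<s @open Y >> B2,
                 phi @^-1` B1 `<=` A, A `<=` phi @^-1` B2 &
                 mu (phi @^-1` (B2 `\` B1)) = 0%E])].

Definition measure_preserving (R : realType) (d : measure_display)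
    (X : measurableType d) (mu : {measure set X -> \bar R}) (T : X -> X) : Prop :=
  measurable_fun setT T /\
  forall A : set X, measurable A -> mu (T @^-1` A) = mu A.

(* Invertibility modulo null sets; a bijection with measurable inverse is the
   special case where both identities hold everywhere. *)
Definition invertible_mod0 (R : realType) (d : measure_display)
    (X : measurableType d) (mu : {measure set X -> \bar R}) (T : X -> X) : Prop :=
  exists S : X -> X,
    [/\ measurable_fun setT S,
        {ae mu, forall x, S (T x) = x} &
        {ae mu, forall x, T (S x) = x}].

Definition ergodic (R : realType) (d : measure_display)
    (X : measurableType d) (mu : probability X R) (T : X -> X) : Prop :=
  forall A : set X, measurable A -> T @^-1` A = A -> mu A = 0%E \/ mu A = 1%E.

Definition ergodic_avg (R : realType) (X : Type) (T : X -> X) (f : X -> R)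
    (N : nat) (x : X) : R :=
  N%:R^-1 * \sum_(1 <= n < N.+1) f (iter n T x).

Definition upper_barrier (R : realType) (d : measure_display)
    (X : measurableType d) (mu : {measure set X -> \bar R}) (F : X -> R) : Prop :=
  exists (p : R) (P : set X),
    [/\ measurable P, (0 < mu P)%E, (forall x, P x -> F x = p) &
        {ae mu, forall y, F y <= p}].

Definition lower_barrier (R : realType) (d : measure_display)
    (X : measurableType d) (mu : {measure set X -> \bar R}) (F : X -> R) : Prop :=
  exists (q : R) (Q : set X),
    [/\ measurable Q, (0 < mu Q)%E, (forall x, Q x -> F x = q) &
        {ae mu, forall y, q <= F y}].

Definition fails_to_fluctuate_on (R : realType) (X : Type) (T : X -> X)
    (f : X -> R) (E : set X) : Prop :=
  forall x, E x ->
    (\forall N \near \oo, 0 <= ergodic_avg T f N x) \/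
    (\forall N \near \oo, ergodic_avg T f N x <= 0).

Definition fails_to_fluctuate_pos (R : realType) (d : measure_display)
    (X : measurableType d) (mu : {measure set X -> \bar R}) (T : X -> X)
    (f : X -> R) : Prop :=
  exists E : set X,
    [/\ measurable E, (0 < mu E)%E & fails_to_fluctuate_on T f E].

(* Main.v *)
(* Write [S_N = f + f \o T + ... + f \o T^(N-1)], so that [N] times the average
   at [x] is [S_N (T x)].  If [f = F - F \o T], then
   [S_N (T x) = F (T x) - F (T^(N+1) x)], which is nonnegative for every [N] when
   [F] attains its essential supremum at [T x].
   Conversely, the candidate is [F = liminf S_N], which satisfies
   [F = f + F \o T].  If the averages are eventually nonnegative on a set of
   positive measure, then [F >= 0] on the image under [T] of this set; by
   ergodicity [F > -oo] a.e., and [F < +oo] a.e. because [f] has mean zero.  Since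
   [S_N = F - F \o T^N], the definition of [F] forces [limsup F \o T^N = 0], hence
   [F <= 0] a.e. by Poincare recurrence: [0] is an upper barrier. *)

Require Import Defs.
From mathcomp Require Import measurable_realfun.
From mathcomp Require Import lra.

Import Order.TTheory GRing.Theory Num.Theory.

Local Open Scope classical_set_scope.
Local Open Scope ring_scope.

(** * Limits inferior of sequences of extended reals *)

Lemma limn_einfE (R : realType) (u : (\bar R)^nat) :
  limn_einf u = ereal_sup (range (einfs u)).
Proof. by rewrite limn_einf_lim; apply: cvg_lim => //; exact: cvg_einfs_sup. Qed.

Lemma limn_einf_ge_near (R : realType) (u : (\bar R)^nat) (l : \bar R) :
  (\forall n \near \oo, (l <= u n)%E) -> (l <= limn_einf u)%E.
Proof.
case=> N _ lu; rewrite limn_einfE.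
apply: (@le_trans _ _ (einfs u N)); last by apply: ereal_sup_ubound; exists N.
by apply/ereal_infP => _ [k /= Nk <-]; exact: lu.
Qed.

Lemma limn_einf_le_frequently (R : realType) (u : (\bar R)^nat) (l : \bar R) :
  (forall n, exists2 k, (n <= k)%N & (u k <= l)%E) -> (limn_einf u <= l)%E.
Proof.
move=> ul; rewrite limn_einfE.
apply/ereal_supP => _ [n _ <-]; have [k nk ukl] := ul n.
by apply: le_trans ukl; apply: ereal_inf_lbound; exists k.
Qed.

Lemma limn_einf_shiftS (R : realType) (u : (\bar R)^nat) :
  limn_einf (fun n => u n.+1) = limn_einf u.
Proof.
rewrite !limn_einf_lim; apply: cvg_lim => //.
have -> : einfs (fun n => u n.+1) = (fun n => einfs u n.+1).
  apply/funext => n; congr ereal_inf; apply/seteqP; split => _ [k /= nk <-].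
    by exists k.+1.
  by case: k nk => // k nk; exists k.
by rewrite (cvg_shiftS (einfs u)); exact: is_cvg_einfs.
Qed.

(** Some tail infimum exceeds [-oo], and putting back the finitely many earlier terms, one real
    number at a time, cannot lower the infimum to [-oo]. *)
Lemma einfs0_gtNy (R : realType) (v : R^nat) :
  (-oo < limn_einf (EFin \o v))%E -> (-oo < einfs (EFin \o v) 0%N)%E.
Proof.
rewrite limn_einfE => /ereal_sup_gt.
move=> [_ [n _ <-]]; elim: n => // n IH lt_n; apply: IH.
apply: (@lt_le_trans _ _ (mine (v n)%:E (einfs (EFin \o v) n.+1))).
  by rewrite lt_min ltNyr.
apply/ereal_infP => _ [k /= nk <-]; rewrite ge_min.
move: nk; rewrite leq_eqVlt => /orP[/eqP ->|nk]; first by rewrite lexx.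
by apply/orP; right; apply: ereal_inf_lbound; exists k.
Qed.

(** * Iterates of a measure-preserving map and recurrence *)

Section dynamics.
Context (R : realType) (d : measure_display) (X : measurableType d).
Context (mu : probability X R) (T : X -> X).
Context (Tmp : measure_preserving mu T).

Let mT : measurable_fun setT T := Tmp.1.

Lemma measurable_iter n : measurable_fun setT (iter n T).
Proof.
elim: n => [|n IH]; first exact: measurable_id.
exact: (measurableT_comp mT IH).
Qed.

Lemma measurable_preimage_iter n A : measurable A -> measurable (iter n T @^-1` A).
Proof. by move=> mA; rewrite -[X in measurable X]setTI; exact: measurable_iter. Qed.

Lemma mu_preimage_iter n A : measurable A -> mu (iter n T @^-1` A) = mu A.
Proof.
elim: n => // n IH mA; rewrite -(IH mA) -(Tmp.2 _ (measurable_preimage_iter n _ mA)).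
by congr (mu _); apply/funext => x /=; rewrite -iterSr.
Qed.

Lemma ae_iter (Q : X -> Prop) : {ae mu, forall x, Q x} ->
  {ae mu, forall x, forall n, Q (iter n T x)}.
Proof.
move=> [N [mN N0 QN]]; apply: ae_foralln => n.
exists (iter n T @^-1` N); split; first exact: measurable_preimage_iter.
  by rewrite -[RHS]N0; exact: mu_preimage_iter.
by move=> x /= nQ; exact: QN.
Qed.

Lemma ae_positive_exists (A : set X) (Q : X -> Prop) :
  measurable A -> (0 < mu A)%E -> {ae mu, forall x, Q x} -> exists2 x, A x & Q x.
Proof.
move=> mA A0 [N [mN N0 QN]]; apply: contrapT => nex.
suff : (mu A <= mu N)%E by rewrite N0 leNgt A0.
apply: le_measure; rewrite ?inE// => x Ax.
by apply: QN => Qx; apply: nex; exists x.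
Qed.

Lemma poincare_recurrence (C : set X) (Q : X -> Prop) :
  measurable C -> (0 < mu C)%E -> {ae mu, forall x, Q x} ->
  exists2 x, Q x & forall n, exists2 k, (n <= k)%N & C (iter k T x).
Proof.
move=> mC C0 aeQ.
pose W n := \bigcup_(k in [set k | (n <= k)%N]) (iter k T @^-1` C).
have mW n : measurable (W n).
  by apply: bigcup_measurable => k _; exact: measurable_preimage_iter.
have mIW : measurable (\bigcap_n W n) by exact: bigcapT_measurable.
have cvgW : mu \o W @ \oo --> mu (\bigcap_n W n).
  apply: nonincreasing_cvg_mu => //; first by rewrite ltey_eq fin_num_measure.
  move=> n m nm; rewrite subsetEset => x [k /= mk Ck].
  by exists k => //=; exact: leq_trans nm mk.
have IW : (mu C <= mu (\bigcap_n W n))%E.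
  rewrite -(cvg_lim _ cvgW) //; apply: lime_ge; first by apply/cvg_ex; eexists; exact: cvgW.
  near=> n; rewrite -(mu_preimage_iter n _ mC) /=.
  apply: le_measure; rewrite ?inE//; first exact: measurable_preimage_iter.
  by move=> x Cx; exists n => /=.
have [x Wx Qx] := ae_positive_exists _ _ mIW (lt_le_trans C0 IW) aeQ.
exists x => // n; have [k nk Ck] := Wx n I.
by exists k.
Unshelve. all: by end_near. Qed.


(** * Truncation and coboundaries dominated by an integrable function *)

Lemma integral_comp_preserving (g : X -> \bar R) : measurable_fun setT g ->
  mu.-integrable setT (g \o T) -> (\int[mu]_x g (T x) = \int[mu]_x g x)%E.
Proof.
move=> mg ig.
rewrite -[LHS](integral_pushforward mT (D := setT) mg ig measurableT).
by apply: eq_measure_integral => A mA _; exact: Tmp.2.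
Qed.

Definition clamp (n r : R) : R := Num.max (- n) (Num.min n r).

Lemma measurable_clamp n : measurable_fun setT (clamp n).
Proof. by apply: measurable_maxr => //; exact: measurable_minr. Qed.

Lemma norm_clamp_le n r : 0 <= n -> `|clamp n r| <= n.
Proof.
move=> n0; rewrite ler_norml /clamp.
by case: (leP n r) => ?; [case: (leP (- n) n)|case: (leP (- n) r)] => ?; lra.
Qed.

(** Truncation is nondecreasing and 1-Lipschitz. A negative [e] would fail, since truncation can
    shrink a negative difference to 0; this is why [Num.max 0 (f x)] appears in [coboundary_eq]. *)
Lemma clampB_le n r s e : 0 <= e -> r - s <= e -> clamp n r - clamp n s <= e.
Proof.
move=> e0 rs; rewrite /clamp.
case: (leP n r) => ?; case: (leP n s) => ?; case: (leP (- n) n) => ?;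
  case: (leP (- n) r) => ?; case: (leP (- n) s) => ?; lra.
Qed.

Lemma clamp_id n r : `|r| <= n -> clamp n r = r.
Proof.
rewrite ler_norml /clamp => /andP[? ?].
by case: (leP n r) => ?; [case: (leP (- n) n)|case: (leP (- n) r)] => ?; lra.
Qed.

(* Fatou's lemma applied to [|f| + f - (g_n - g_n \o T)], where [g_n] is [g]
   truncated to [[-n, n]]: these functions are nonnegative, and their integral
   is that of [|f|] since each [g_n] is integrable. *)
Lemma coboundary_eq (f g : X -> R) :
  mu.-integrable setT (EFin \o f) -> (\int[mu]_x (f x)%:E = 0)%E ->
  measurable_fun setT g ->
  (forall x, g x - g (T x) <= Num.max 0 (f x)) ->
  {ae mu, forall x, g x - g (T x) <= f x} ->
  {ae mu, forall x, f x = g x - g (T x)}.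
Proof.
move=> intf f0 mg gf aegf.
have mf : measurable_fun setT f.
  by apply/measurable_EFinP; exact: (measurable_int mu intf).
pose c (n : nat) := clamp n%:R.
have mc n : measurable_fun setT (c n \o g).
  exact: measurableT_comp (measurable_clamp _) mg.
have ic n : mu.-integrable setT (EFin \o (c n \o g)).
  apply: measurable_bounded_integrable => //.
    by rewrite ltey_eq fin_num_measure.
  exists n%:R; split => // M nM x _ /=.
  by apply: le_trans (ltW nM); exact: norm_clamp_le.
have icT n : mu.-integrable setT (EFin \o (c n \o g \o T)).
  apply: measurable_bounded_integrable => //.
  - by rewrite ltey_eq fin_num_measure.
  - exact: measurableT_comp.
  exists n%:R; split => // M nM x _ /=.
  by apply: le_trans (ltW nM); exact: norm_clamp_le.
have iabs : mu.-integrable setT (EFin \o (fun x => `|f x|)).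
  exact: (integrable_abse intf).
(* Both sides are 0 when [f x <= 0]; otherwise this reads [f x <= 2 f x]. The right side is thus a
   nonnegative bound that survives truncation. *)
have gfm x : Num.max 0 (f x) <= `|f x| + f x.
  have := ler_norm (- f x); have := normr_ge0 (f x).
  by rewrite normrN; case: (leP 0 (f x)); lra.
pose h n x := (`|f x| + f x - (c n (g x) - c n (g (T x))))%:E.
pose v x := f x - (g x - g (T x)).
have inth n : (\int[mu]_x h n x = \int[mu]_x (`|f x|)%:E)%E.
  rewrite /h; under eq_integral do rewrite EFinB EFinD EFinB.
  rewrite integralB//=; [|exact: (integrableD measurableT iabs intf)|exact: (integrableB measurableT (ic n) (icT n))].
  rewrite (integralD measurableT iabs intf) (integralB measurableT (ic n) (icT n)).
  have -> := integral_comp_preserving (EFin \o (c n \o g)) _ (icT n); last first.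
    exact/measurable_EFinP.
  by rewrite f0 adde0 subee ?sube0//; exact: (integrable_fin_num measurableT (ic n)).
have mgT : measurable_fun setT (g \o T) by exact: measurableT_comp.
have mv : measurable_fun setT v.
  by apply: measurable_funB => //; exact: measurable_funB.
have mabs : measurable_fun setT (fun x => `|f x|) by exact: measurableT_comp.
have vabs0 x : 0 <= `|f x| + v x.
  by rewrite addrA subr_ge0; exact: le_trans (gf x) (gfm x).
have mh n : measurable_fun setT (h n).
  apply/measurable_EFinP; apply: measurable_funB.
    exact: measurable_funD.
  exact: (measurable_funB (mc n) (measurableT_comp (mc n) mT)).
have h0 n x : setT x -> (0 <= h n x)%E.
  move=> _; rewrite lee_fin subr_ge0; apply: clampB_le.
    by apply: le_trans (gfm x); rewrite le_max lexx.
  exact: le_trans (gf x) (gfm x).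
(* At a fixed [x] the sequence is constant once [n] exceeds both [|g x|] and [|g (T x)|]. *)
have hlim x : limn_einf (h ^~ x) = (`|f x| + v x)%:E.
  apply: (cvg_limn_einf_sup _).1; apply: cvg_near_cst.
  near=> n.
  have gn : `|g x| <= n%:R by near: n; exact: nbhs_infty_ger.
  have gTn : `|g (T x)| <= n%:R by near: n; exact: nbhs_infty_ger.
  by rewrite /h /c !clamp_id// /v addrA.
have := fatou mu measurableT mh h0.
under eq_integral do rewrite hlim.
under [X in (_ <= limn_einf X)%E]eq_fun do rewrite inth.
rewrite (cvg_limn_einf_sup (cvg_cst _)).1 => fat.
have ivabs : mu.-integrable setT (EFin \o (fun x => `|f x| + v x)).
  apply/integrableP; split; first by apply/measurable_EFinP; exact: measurable_funD.
  under eq_integral do rewrite /= ger0_norm//.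
  apply: le_lt_trans fat _; rewrite ltey_eq; apply/orP; left.
  exact: integrable_fin_num.
have iv : mu.-integrable setT (EFin \o v).
  have -> : EFin \o v = (fun x => (`|f x| + v x)%:E - (`|f x|)%:E)%E.
    by apply/funext => x /=; rewrite -EFinB addrAC subrr add0r.
  exact: (integrableB measurableT ivabs iabs).
(* The finite integral of [|f|] cancels from both sides of Fatou's inequality. As [v >= 0] almost
   everywhere, this forces [v = 0] almost everywhere. *)
have intv : (\int[mu]_x (v x)%:E <= 0)%E.
  move: fat; under eq_integral do rewrite EFinD.
  rewrite (integralD measurableT iabs iv).
  have fabs := integrable_fin_num measurableT iabs.
  by rewrite -leeBrDl// subee.
have aev : {ae mu, forall x, `|v x| = v x}.
  by apply: filterS aegf => x gfx; rewrite ger0_norm// subr_ge0.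
have : (\int[mu]_x `|(v x)%:E| = 0)%E.
  apply/eqP; rewrite eq_le integral_ge0// andbT.
  rewrite (ae_eq_integral (EFin \o v))//; [exact/measurable_EFinP/measurableT_comp|exact/measurable_EFinP|].
  by apply: filterS aev => x /= vx _; rewrite vx.
move/(ae_eq_integral_abs mu measurableT); move=> /(_ (measurable_int mu iv)).
apply: filterS => x /(_ I) [] /eqP; rewrite subr_eq0 => /eqP //.
Unshelve. all: by end_near. Qed.

Lemma exists_positive_bigcup (A : (set X)^nat) :
  (forall n, measurable (A n)) -> (0 < mu (\bigcup_n A n))%E ->
  exists n, (0 < mu (A n))%E.
Proof.
move=> mA; apply: contraPP => /forallNP A0; apply/negP; rewrite -leNgt.
have mU : measurable (\bigcup_n A n) by exact: bigcupT_measurable.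
suff -> : mu (\bigcup_n A n) = 0%E by rewrite lexx.
apply/negligibleP => //; apply: negligible_bigcup => n; apply/negligibleP => //.
by apply/eqP; rewrite eq_le measure_ge0 andbT leNgt; apply/negP; exact: A0.
Qed.

(** * Birkhoff sums, their limit inferior and their infimum *)

Definition birkhoff_sum (f : X -> R) (N : nat) (x : X) : R :=
  \sum_(0 <= k < N) f (iter k T x).

Definition birkhoff_liminf (f : X -> R) (x : X) : \bar R :=
  limn_einf (fun N => (birkhoff_sum f N x)%:E).

(** The infimum includes the empty sum [N = 0], so it is at most 0. *)
Definition birkhoff_inf (f : X -> R) (x : X) : \bar R :=
  einfs (fun N => (birkhoff_sum f N x)%:E) 0%N.

Lemma birkhoff_sumS f N x :
  birkhoff_sum f N.+1 x = f x + birkhoff_sum f N (T x).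
Proof.
rewrite /birkhoff_sum big_nat_recl//=; congr (_ + _).
by apply: eq_bigr => k _; rewrite -iterSr.
Qed.

Lemma ergodic_avgE f N x :
  ergodic_avg T f N x = N%:R^-1 * birkhoff_sum f N (T x).
Proof.
rewrite /ergodic_avg big_add1 /=; congr (_ * _).
by apply: eq_bigr => k _; rewrite -iterSr.
Qed.

Lemma birkhoff_sum_coboundary (f g : X -> R) N x :
  (forall k, f (iter k T x) = g (iter k T x) - g (T (iter k T x))) ->
  birkhoff_sum f N x = g x - g (iter N T x).
Proof.
move=> fg; elim: N => [|N IH]; first by rewrite /birkhoff_sum big_geq// subrr.
rewrite /birkhoff_sum big_nat_recr//= -/(birkhoff_sum f N x) IH fg.
by rewrite addrA subrK.
Qed.

Lemma birkhoff_sumN f N x :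
  birkhoff_sum (fun x => - f x) N x = - birkhoff_sum f N x.
Proof. by rewrite /birkhoff_sum sumrN. Qed.

Lemma birkhoff_liminf_step f x :
  birkhoff_liminf f x = ((f x)%:E + birkhoff_liminf f (T x))%E.
Proof.
rewrite /birkhoff_liminf -limn_einf_shift// -limn_einf_shiftS.
by congr limn_einf; apply/funext => N; rewrite birkhoff_sumS EFinD.
Qed.

Lemma birkhoff_liminf_iter f N x :
  birkhoff_liminf f x =
  ((birkhoff_sum f N x)%:E + birkhoff_liminf f (iter N T x))%E.
Proof.
elim: N x => [|N IH] x; first by rewrite /birkhoff_sum big_geq// add0e.
by rewrite birkhoff_liminf_step IH birkhoff_sumS EFinD addeA -iterSr.
Qed.

(** The term 0 of the minimum comes from [N = 0]; the other sums are [f x] plus a Birkhoff sum at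
    [T x]. *)
Lemma birkhoff_inf_step f x :
  birkhoff_inf f x = mine 0%E ((f x)%:E + birkhoff_inf f (T x)).
Proof.
apply/eqP; rewrite eq_le; apply/andP; split.
  rewrite le_min; apply/andP; split.
    apply: ereal_inf_lbound; exists 0%N => //.
    by rewrite /birkhoff_sum big_geq.
  rewrite -leeBlDl//; apply/ereal_infP => _ [N _ <-].
  rewrite leeBlDl// -EFinD -birkhoff_sumS.
  by apply: ereal_inf_lbound; exists N.+1.
apply/ereal_infP => _ [[|N] _ <-]; rewrite ge_min.
  by rewrite /birkhoff_sum big_geq// lexx.
rewrite birkhoff_sumS EFinD leeD2lE//; apply/orP; right.
by apply: ereal_inf_lbound; exists N.
Qed.

Lemma measurable_birkhoff_sum f N : measurable_fun setT f ->
  measurable_fun setT (birkhoff_sum f N).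
Proof.
move=> mf; apply: measurable_sum => k.
exact: (measurableT_comp mf (measurable_iter k)).
Qed.

Lemma measurable_birkhoff_liminf f : measurable_fun setT f ->
  measurable_fun setT (birkhoff_liminf f).
Proof.
move=> mf; rewrite /birkhoff_liminf.
apply: measurableT_comp => //.
apply: measurable_fun_limn_esup => N.
apply: measurableT_comp => //; apply/measurable_EFinP.
exact: measurable_birkhoff_sum.
Qed.

Lemma measurable_birkhoff_inf f : measurable_fun setT f ->
  measurable_fun setT (birkhoff_inf f).
Proof.
move=> mf.
apply: (measurable_fun_einfs (f := fun N x => (birkhoff_sum f N x)%:E)) => N.
by apply/measurable_EFinP; exact: measurable_birkhoff_sum.
Qed.

(** * Mean-zero functions over an ergodic map *)

Context (Terg : ergodic mu T).

Lemma ergodic_ae (A : set X) : measurable A -> T @^-1` A = A ->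
  (0 < mu A)%E -> {ae mu, forall x, A x}.
Proof.
move=> mA TA A0; have [A0'|A1] := Terg _ mA TA; first by rewrite A0' ltxx in A0.
exists (~` A); split; [exact: measurableC| |by []].
by rewrite probability_setC// A1 subee.
Qed.

Section mean_zero.
Context (f : X -> R).
Context (intf : mu.-integrable setT (EFin \o f)).
Context (f0 : (\int[mu]_x (f x)%:E = 0)%E).

Let mf : measurable_fun setT f.
Proof. by apply/measurable_EFinP; exact: measurable_int intf. Qed.

(** [birkhoff_liminf_step] holds at every point, so a set [B] invariant under real translations has
    a strictly invariant preimage, as [ergodic] demands. *)
Let preimage_birkhoff_liminf (B : set \bar R) :
  (forall r y, B (r%:E + y)%E = B y) ->
  T @^-1` (birkhoff_liminf f @^-1` B) = birkhoff_liminf f @^-1` B.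
Proof.
by move=> rB; apply/funext => x /=; rewrite [in RHS]birkhoff_liminf_step rB.
Qed.

Let measurable_preimage_liminf (B : set \bar R) : measurable B ->
  measurable (birkhoff_liminf f @^-1` B).
Proof.
move=> mB; rewrite -[X in measurable X]setTI.
exact: measurable_birkhoff_liminf.
Qed.

(* Otherwise the infimum [m] of the Birkhoff sums is finite a.e. and satisfies
   [m = min 0 (f + m \o T)], so that [f = m - m \o T] a.e. and the Birkhoff
   sums are [m - m \o T^N], which cannot diverge by recurrence. *)
Lemma birkhoff_liminf_lty : mu (birkhoff_liminf f @^-1` [set +oo%E]) = 0%E.
Proof.
set G := _ @^-1` _.
have mG : measurable G by apply: measurable_preimage_liminf; exact: emeasurable_set1.
apply: contrapT => /eqP; rewrite neq_lt ltNge measure_ge0/= => G0.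
have aeG : {ae mu, forall x, G x}.
  apply: ergodic_ae => //; apply: preimage_birkhoff_liminf => r [s| |] //=.
  by apply/propext; split.
pose m x := fine (birkhoff_inf f x).
have Gfin x : G x -> birkhoff_inf f x \is a fin_num.
  rewrite /G /= => Gx; rewrite fin_numE; apply/andP; split.
    by rewrite gt_eqF//; apply: einfs0_gtNy; rewrite -/(birkhoff_liminf f x) Gx.
  by rewrite birkhoff_inf_step lt_eqF// gt_min ltey.
have mm : measurable_fun setT m.
  by apply: measurableT_comp => //; exact: measurable_birkhoff_inf.
(* If the infimum at [T x] is infinite, [fine] makes both terms on the left 0, which only the
   maximum with 0 bounds. Where it is finite, [f x] itself is a bound. *)
have mle x : m x - m (T x) <= Num.max 0 (f x).
  rewrite /m birkhoff_inf_step; case: (birkhoff_inf f (T x)) => [r| |] /=.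
  - rewrite -EFinD -EFin_min /= ; case: (leP 0 (f x)); case: (leP 0 (f x + r)); lra.
  - by rewrite addey// /mine ltry /= subrr le_max lexx.
  - by rewrite /mine /= subrr le_max lexx.
have aem : {ae mu, forall x, m x - m (T x) <= f x}.
  apply: filterS (ae_iter _ aeG) => x Gx.
  have := Gfin _ (Gx 1%N); rewrite /m (birkhoff_inf_step f x) /=.
  case: (birkhoff_inf f (T x)) => // r _ /=.
  by rewrite -EFinD -EFin_min /=; case: (leP 0 (f x + r)); lra.
have aefm := ae_iter _ (coboundary_eq _ _ intf f0 mm mle aem).
have mK (K : nat) : measurable [set x | - K%:R <= m x].
  by rewrite -[X in measurable X]setTI; exact: measurable_fun_le.
(* These sets exhaust [X] because [m] is real-valued. Returning to one of them infinitely often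
   keeps the sums [m x - m (T^k x)] below [m x + K] infinitely often. *)
have [K K0] : exists K : nat, (0 < mu [set x | - K%:R <= m x]%R)%E.
  apply: exists_positive_bigcup => //.
  rewrite [X in mu X](_ : _ = setT) ?probability_setT//.
  apply/seteqP; split => // x _; exists (Num.truncn `|m x|).+1 => //=.
  rewrite lerNl; apply: le_trans (ler_norm _) _.
  by rewrite normrN; apply/ltW/truncnS_gt.
have [x [Gx fm] Kx] := poincare_recurrence _ _ (mK K) K0 (filterI aeG aefm).
have : (birkhoff_liminf f x <= (m x + K%:R)%:E)%E.
  apply: limn_einf_le_frequently => n; have [k nk Kk] := Kx n.
  exists k => //; rewrite (birkhoff_sum_coboundary _ m)// lee_fin.
  by move: Kk => /=; lra.
by rewrite Gx.
Qed.

Context (pos : (0 < mu (birkhoff_liminf f @^-1` [set y | 0 <= y]))%E).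

Lemma birkhoff_liminf_fin : {ae mu, forall x, birkhoff_liminf f x \is a fin_num}.
Proof.
have aeNy : {ae mu, forall x, (birkhoff_liminf f @^-1` [set y | -oo < y]%E) x}.
  apply: ergodic_ae.
  - by apply: measurable_preimage_liminf; rewrite -set_itvoy; exact: emeasurable_itv.
  - by apply: preimage_birkhoff_liminf => r [s| |] //=; rewrite !ltNyr.
  - apply: lt_le_trans pos _; apply: le_measure; rewrite ?inE.
    + by apply: measurable_preimage_liminf; rewrite -set_itvcy; exact: emeasurable_itv.
    + by apply: measurable_preimage_liminf; rewrite -set_itvoy; exact: emeasurable_itv.
    + by move=> x /=; exact: lt_le_trans.
have aey : {ae mu, forall x, birkhoff_liminf f x <> +oo%E}.
  exists (birkhoff_liminf f @^-1` [set +oo%E]); split.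
  - by apply: measurable_preimage_liminf; exact: emeasurable_set1.
  - exact: birkhoff_liminf_lty.
  - by move=> x /contrapT.
apply: filterS2 aeNy aey => x /= Ny y.
by rewrite fin_numE gt_eqF//; exact/eqP.
Qed.

(** Write [F] for the limit inferior. If [F > 0] on a set of positive measure, then so is
    [F >= 1/(n+1)] for some [n], and some orbit with [F x] finite meets that set infinitely often.
    At those times the sum [F x - F (T^k x)] is at most [F x - 1/(n+1)], so [F x] would be too. *)
Lemma birkhoff_liminf_le0 : {ae mu, forall x, birkhoff_liminf f x <= 0}%E.
Proof.
pose C n := birkhoff_liminf f @^-1` [set y | (n.+1%:R^-1%:E <= y)%E].
have mC n : measurable (C n).
  by apply: measurable_preimage_liminf; rewrite -set_itvcy; exact: emeasurable_itv.
have CU : birkhoff_liminf f @^-1` [set y | 0 < y]%E `<=` \bigcup_n C n.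
  move=> x /=; case fx : (birkhoff_liminf f x) => [r| |] //.
    rewrite lte_fin => r0; exists (Num.truncn r^-1) => //; rewrite /C /= fx lee_fin.
    rewrite invf_ple ?posrE//; exact/ltW/truncnS_gt.
  by move=> _; exists 0%N; rewrite //= /C /= fx leey.
have [C0|] := eqVneq (mu (\bigcup_n C n)) 0%E.
  exists (\bigcup_n C n); split => //; first exact: bigcupT_measurable.
  by move=> x /= /negP; rewrite -ltNge; exact: CU.
rewrite neq_lt ltNge measure_ge0/= => /(exists_positive_bigcup _ mC)[n Cn].
have [x fx Cx] := poincare_recurrence _ _ (mC n) Cn birkhoff_liminf_fin.
exfalso; have : (birkhoff_liminf f x <= birkhoff_liminf f x - n.+1%:R^-1%:E)%E.
  apply: limn_einf_le_frequently => N; have [k Nk Ck] := Cx N; exists k => //.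
  by rewrite leeBrDr// [leRHS](birkhoff_liminf_iter f k) leeD2lE.
by rewrite leeBrDr// -[leRHS]adde0 leeD2lE// lee_fin leNgt invr_gt0 ltr0Sn.
Qed.

(** The limit inferior is at least 0 on the set in [pos] and at most 0 almost everywhere, hence 0 on
    a set of positive measure. The default value of [fine] intervenes only on a null set. *)
Lemma coboundary_max0 : exists F : X -> R,
  [/\ measurable_fun setT F, {ae mu, forall x, f x = F x - F (T x)},
      {ae mu, forall x, F x <= 0} & (0 < mu [set x | F x = 0]%R)%E].
Proof.
exists (fine \o birkhoff_liminf f).
have mF : measurable_fun setT (fine \o birkhoff_liminf f).
  by apply: measurableT_comp => //; exact: measurable_birkhoff_liminf.
split => //.
(* Finiteness is needed at [T x], so that its value can be cancelled. *)
- apply: filterS (ae_iter _ birkhoff_liminf_fin) => x fx /=.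
  rewrite birkhoff_liminf_step; have := fx 1%N => /=.
  by case: (birkhoff_liminf f (T x)) => // r _ /=; rewrite addrK.
- by apply: filterS birkhoff_liminf_le0 => x; exact: fine_le0.
- have mF0 : measurable [set x | (fine \o birkhoff_liminf f) x = 0].
    by rewrite -[X in measurable X]setTI; exact: (mF measurableT [set 0]).
  have mP : measurable (birkhoff_liminf f @^-1` [set y | 0 <= y]%E).
    by apply: measurable_preimage_liminf; rewrite -set_itvcy; exact: emeasurable_itv.
  have [N [mN N0 FN]] := birkhoff_liminf_le0.
  apply: lt_le_trans pos _; rewrite -[leRHS]adde0 -[X in (_ + X)%E]N0.
  apply: le_trans (measureU2 _ _ _); rewrite //.
  apply: le_measure; rewrite ?inE//; first exact: measurableU.
  move=> x /= Fx; have [Nx|Nx] := pselect (N x); [by right|left].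
  have : (birkhoff_liminf f x <= 0)%E by apply: contrapT => /FN.
  by move=> Fx'; have /eqP -> : birkhoff_liminf f x == 0%E by rewrite eq_le Fx Fx'.
Qed.

End mean_zero.

(** * Barriers and failure to fluctuate *)

(** Changing the sign of [f] exchanges the two alternatives, which reduces lower barriers to upper
    ones. *)
Lemma fails_to_fluctuate_posN f :
  fails_to_fluctuate_pos mu T (fun x => - f x) -> fails_to_fluctuate_pos mu T f.
Proof.
move=> [E [mE E0 fE]]; exists E; split => // x /fE.
have avgN N : ergodic_avg T (fun x => - f x) N x = - ergodic_avg T f N x.
  by rewrite !ergodic_avgE birkhoff_sumN mulrN.
by case=> fx; [right|left]; apply: filterS fx => N; rewrite avgN; lra.
Qed.

Lemma upper_barrier_fails_to_fluctuate (F f : X -> R) :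
  upper_barrier mu F -> (forall x, f x = F x - F (T x)) ->
  fails_to_fluctuate_pos mu T f.
Proof.
move=> [p [P [mP P0 FP Fp]]] fF; have [N [mN N0 FN]] := ae_iter _ Fp.
have mTP : measurable (T @^-1` P) by exact: (measurable_preimage_iter 1).
(* The preimage of [P] is taken because the averages at [x] start at [T x]. The null set [N]
   contains every point whose orbit exceeds [p] at some time. *)
have mE : measurable (T @^-1` P `\` N) by exact: measurableD.
exists (T @^-1` P `\` N); split => //.
  rewrite -(Tmp.2 _ mP) in P0; apply: lt_le_trans P0 _.
  rewrite -[leRHS]adde0 -[X in (_ + X)%E]N0.
  apply: le_trans (measureU2 _ _ _); rewrite //.
  apply: le_measure; rewrite ?inE//; first exact: measurableU.
  by move=> x Px; have [Nx|Nx] := pselect (N x); [right|left].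
move=> x [/= Px Nx]; left; apply: nearW => n.
rewrite ergodic_avgE (birkhoff_sum_coboundary _ F)// mulr_ge0 ?invr_ge0//.
have Fx : forall k, F (iter k T x) <= p by apply: contrapT => /FN.
by rewrite (FP _ Px) -iterSr subr_ge0.
Qed.

Lemma upper_barrier_coboundary f :
  mu.-integrable setT (EFin \o f) -> (\int[mu]_x (f x)%:E = 0)%E ->
  (0 < mu (birkhoff_liminf f @^-1` [set y | 0 <= y]))%E ->
  exists F : X -> R, [/\ measurable_fun setT F,
    {ae mu, forall x, f x = F x - F (T x)} & upper_barrier mu F].
Proof.
move=> intf f0 /(coboundary_max0 _ intf f0)[F [mF fF F0 Fmax]].
exists F; split => //; exists 0, [set x | F x = 0]; split => //.
by rewrite -[X in measurable X]setTI; exact: (mF measurableT [set 0]).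
Qed.

(** Each point of [E] is sent by [T] into one of the two sets. As [T] preserves [mu], their measures
    add up to at least [mu E]. *)
Lemma fails_to_fluctuate_liminf f : measurable_fun setT f ->
  fails_to_fluctuate_pos mu T f ->
  (0 < mu (birkhoff_liminf f @^-1` [set y | 0 <= y]))%E \/
  (0 < mu (birkhoff_liminf (fun x => - f x)%R @^-1` [set y | 0 <= y]))%E.
Proof.
move=> mf [E [mE E0 fE]].
have mL g : measurable_fun setT g ->
    measurable (birkhoff_liminf g @^-1` [set y | 0 <= y]%E).
  move=> mg; rewrite -[X in measurable X]setTI.
  apply: (measurable_birkhoff_liminf g mg) => //.
  by rewrite -set_itvcy; exact: emeasurable_itv.
have mfN : measurable_fun setT (fun x => - f x) by exact: measurableT_comp.
have mLT g (mg : measurable_fun setT g) := measurable_preimage_iter 1 _ (mL g mg).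
have avg_ge0 g x : (\forall N \near \oo, 0 <= ergodic_avg T g N x) ->
    (0 <= birkhoff_liminf g (T x))%E.
  move=> gx; apply: limn_einf_ge_near; apply: filterS2 (nbhs_infty_gt 0) gx => N N0.
  by rewrite ergodic_avgE pmulr_rge0 ?invr_gt0 ?ltr0n// lee_fin.
have EU : E `<=` iter 1 T @^-1` (birkhoff_liminf f @^-1` [set y | 0 <= y]%E) `|`
    iter 1 T @^-1` (birkhoff_liminf (fun x => - f x) @^-1` [set y | 0 <= y]%E).
  move=> x /fE[fx|fx]; [left|right]; apply: avg_ge0 => //.
  by apply: filterS fx => N; rewrite !ergodic_avgE birkhoff_sumN mulrN; lra.
have : (0 < mu (birkhoff_liminf f @^-1` [set y | 0 <= y]) +
            mu (birkhoff_liminf (fun x => - f x)%R @^-1` [set y | 0 <= y]))%E.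
  apply: lt_le_trans E0 _.
  rewrite -(mu_preimage_iter 1 _ (mL _ mf)) -(mu_preimage_iter 1 _ (mL _ mfN)).
  apply: le_trans (measureU2 _ (mLT _ mf) (mLT _ mfN)).
  by apply: le_measure; rewrite ?inE//; apply: measurableU; exact: mLT.
set a := mu _; set b := mu _ => ab.
have [a0|a0] := ltP 0%E a; [by left|right].
rewrite ltNge; apply/negP => b0; move: ab; rewrite ltNge => /negP; apply.
exact: adde_le0.
Qed.

End dynamics.

Theorem theorem3p6 (R : realType) (d : measure_display) (X : measurableType d)
    (mu : probability X R) (T : X -> X)
    (Xstd : standard_space mu)
    (Tmp : measure_preserving mu T)
    (Tinv : invertible_mod0 mu T)
    (Terg : ergodic mu T) :
  (forall F : X -> R,
     measurable_fun [set: X] F ->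
     upper_barrier mu F \/ lower_barrier mu F ->
     forall f : X -> R,
       (forall x, f x = F x - F (T x)) ->
       mu.-integrable [set: X] (fun x => (f x)%:E) ->
       (\int[mu]_x (f x)%:E)%E = 0%E ->
       fails_to_fluctuate_pos mu T f)
  /\
  (forall f : X -> R,
     mu.-integrable [set: X] (fun x => (f x)%:E) ->
     (\int[mu]_x (f x)%:E)%E = 0%E ->
     fails_to_fluctuate_pos mu T f ->
     exists F : X -> R,
       [/\ measurable_fun [set: X] F,
           {ae mu, forall x, f x = F x - F (T x)} &
           upper_barrier mu F \/ lower_barrier mu F]).
Proof.
split.
  move=> F _ [Fup|[q [Q [mQ Q0 FQ Fq]]]] f fF _ _.
    exact: upper_barrier_fails_to_fluctuate Fup fF.
  (* A lower barrier [q] of [F] is an upper barrier [-q] of [-F], whose coboundary is [-f]. *)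
  apply: fails_to_fluctuate_posN.
  apply: (upper_barrier_fails_to_fluctuate _ _ _ _ _ Tmp (fun x => - F x)).
    exists (- q), Q; split => // [x /FQ ->//|].
    by apply: filterS Fq => x; rewrite lerN2.
  by move=> x; rewrite fF opprB opprK addrC.
move=> f intf f0 /fails_to_fluctuate_liminf-/(_ Tmp)[||].
- by apply/measurable_EFinP; exact: measurable_int intf.
- move=> /(upper_barrier_coboundary _ _ _ _ _ Tmp Terg _ intf f0)[F [mF fF Fup]].
  by exists F; split => //; left.
(* The case of eventually nonpositive averages: an upper barrier [p] for the solution [F] belonging
   to [-f] becomes a lower barrier [-p] for [-F]. *)
- have intfN : mu.-integrable setT (EFin \o (fun x => - f x)) by exact: integrableN intf.
  move=> /(upper_barrier_coboundary _ _ _ _ _ Tmp Terg _ intfN)[|F [mF fF [p [P [mP P0 FP Fp]]]]].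
    under eq_integral do rewrite EFinN.
    by rewrite integralN ?f0 ?oppe0//; exact: integrable_add_def.
  exists (fun x => - F x); split.
  + exact: measurableT_comp.
  + by apply: filterS fF => x; lra.
  + right; exists (- p), P; split => // [x /FP ->//|].
    by apply: filterS Fp => x; rewrite lerN2.
Qed.
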